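(* Let $n,m\ge 1$ be integers. (a) $C_{1,n,1}$ and $C_{2,m,0}$ intersect transversally (at all of their points of intersection). (b) $C_{1,n,1}$ and $C_{2,m,1}$ intersect transversally (at all of their points of intersection).
   Context: Let $\mathcal{P}_3^{\mathrm{crit}}$ be the moduli space of cubic polynomials with marked critical points: its points are equivalence classes of triples $(f,c_1,c_2)$, where $f\in\mathbb{C}[z]$ has degree $3$ and $c_1,c_2$ are the critical points of $f$ (counted with multiplicity), modulo conjugation by affine maps $z\mapsto\alpha z+\beta$, $\alpha\ne0$. Write $f^k$ for the $k$-th iterate of $f$, with $f^0$ the identity. For $i,j\ge1$ and $n,m\ge 1$ define $$C_{1,n,i}=\{(f,c_1,c_2)\in\mathcal{P}_3^{\mathrm{crit}} : f^{i+n}(c_1)=f^i(c_1)\text{ and } f^{i-1+n}(c_1)\ne f^{i-1}(c_1)\},$$ $$C_{2,m,j}=\{(f,c_1,c_2)\in\mathcal{P}_3^{\mathrm{crit}} : f^{j+m}(c_2)=f^j(c_2)\text{ and } f^{j-1+m}(c_2)\ne f^{j-1}(c_2)\},$$ and let $C_{1,n,0}=\{(f,c_1,c_2): f^n(c_1)=c_1\}$ and $C_{2,m,0}=\{(f,c_1,c_2): f^m(c_2)=c_2\}$. Meaning of transversality: after an affine change of variables every triple may be put in the form $(f_{x,y},x,-x)$ with $f_{x,y}(z)=z^3-3x^2z+y$, $(x,y)\in\mathbb{C}^2$, and transversality is understood in the coordinates $(x,y)$. The curve $C_{1,n,i}$ is cut out by the equation $P(x,y)=f_{x,y}^{i+n}(x)-f_{x,y}^i(x)=0$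 on the open set where $f_{x,y}^{i-1+n}(x)\neq f_{x,y}^{i-1}(x)$ (no open condition if $i=0$), and $C_{2,m,j}$ is cut out by $Q(x,y)=f_{x,y}^{j+m}(-x)-f_{x,y}^j(-x)=0$ on the open set where $f_{x,y}^{j-1+m}(-x)\neq f_{x,y}^{j-1}(-x)$ (no open condition if $j=0$). The curves intersect transversally at a point $(\alpha,\beta)$ lying on both if and only if the Jacobian determinant $P_xQ_y-P_yQ_x$ does not vanish at $(\alpha,\beta)$. *)

(* Defs.v *)
From HB Require Import structures.
From mathcomp Require Import all_boot all_order all_algebra.
From mathcomp Require Import ring.
From mathcomp Require Import complex mpoly boolp classical_sets reals.

Set Implicit Arguments.
Unset Strict Implicit.
Unset Printing Implicit Defensive.

Import GRing.Theory Num.Theory.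
Local Open Scope ring_scope.
Local Open Scope quotient_scope.
Local Open Scope classical_set_scope.

Section CubicModuli.
Variable R : realType.
Local Notation C := R[i].

(* The equation on f^`() says that c1, c2 are the critical points of f counted
   with multiplicity. *)
Definition is_marked_cubic (t : {poly C} * C * C) : bool :=
  let: (f, c1, c2) := t in
  (size f == 4) &&
  (f^`() == lead_coef f^`() *: (('X - c1%:P) * ('X - c2%:P))).

Record markedCubic := MarkedCubic {
  mc_val :> {poly C} * C * C;
  mc_valP : is_marked_cubic mc_val }.

HB.instance Definition _ := [isSub for mc_val].
HB.instance Definition _ := [Choice of markedCubic by <:].

Definition mc_map (T : markedCubic) : {poly C} := (mc_val T).1.1.
Definition mc_crit1 (T : markedCubic) : C := (mc_val T).1.2.
Definition mc_crit2 (T : markedCubic) : C := (mc_val T).2.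

(* phi (z) = a z + b conjugates T to U: phi o f_T = f_U o phi, and phi sends
   marked critical points to marked critical points. *)
Definition conj_by (a b : C) (T U : markedCubic) : Prop :=
  let phi := a *: 'X + b%:P in
  [/\ phi \Po mc_map T = mc_map U \Po phi,
      mc_crit1 U = phi.[mc_crit1 T] & mc_crit2 U = phi.[mc_crit2 T]].

Definition affine_conj (T U : markedCubic) : bool :=
  `[< exists a b : C, a != 0 /\ conj_by a b T U >].

Lemma affine_conj_refl : reflexive affine_conj.
Proof.
move=> T; apply/asboolP; exists 1, 0; rewrite oner_neq0; split=> //.
by rewrite /conj_by scale1r addr0 comp_polyX comp_polyXr !hornerX.
Qed.

Lemma conj_by_inv (a b : C) (T U : markedCubic) :
  a != 0 -> conj_by a b T U -> conj_by a^-1 (- (a^-1 * b)) U T.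
Proof.
move=> a0 [hf h1 h2].
have e1 : (a^-1 *: 'X + (- (a^-1 * b))%:P) \Po (a *: 'X + b%:P) = 'X :> {poly C}.
  rewrite comp_polyD comp_polyZ comp_polyX comp_polyC scalerDr scalerA mulVf //.
  by rewrite scale1r -mul_polyC -polyCM -addrA -polyCD subrr addr0.
have e2 : (a *: 'X + b%:P) \Po (a^-1 *: 'X + (- (a^-1 * b))%:P) = 'X :> {poly C}.
  rewrite comp_polyD comp_polyZ comp_polyX comp_polyC scalerDr scalerA mulfV //.
  rewrite scale1r -mul_polyC -polyCM mulrN mulrA mulfV // mul1r -addrA -polyCD.
  by rewrite addrC addNr add0r.
rewrite /conj_by h1 h2 -!horner_comp e1 !hornerX; split=> //.
set psi := a^-1 *: _ + _; set phi := a *: _ + _ in hf e1 e2.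
rewrite -[LHS]comp_polyXr -e2 -!comp_polyA [mc_map U \Po _]comp_polyA -hf.
by rewrite !comp_polyA e1 comp_polyX.
Qed.

Lemma affine_conj_sym : ssrbool.symmetric affine_conj.
Proof.
have H T U : affine_conj T U -> affine_conj U T.
  case/asboolP=> a [b [a0 h]]; apply/asboolP.
  by exists a^-1, (- (a^-1 * b)); rewrite invr_eq0; split=> //; apply: conj_by_inv.
by move=> T U; apply/idP/idP; apply: H.
Qed.

Lemma affine_conj_trans : transitive affine_conj.
Proof.
move=> U T V /asboolP[a [b [a0 [f1 g1 h1]]]] /asboolP[c [d [c0 [f2 g2 h2]]]].
apply/asboolP; exists (c * a), (c * b + d); rewrite mulf_neq0 //; split=> //.
rewrite /conj_by; have -> : (c * a) *: 'X + (c * b + d)%:P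
   = (c *: 'X + d%:P) \Po (a *: 'X + b%:P) :> {poly C}.
  rewrite comp_polyD comp_polyZ comp_polyX comp_polyC scalerDr scalerA.
  by rewrite -[c *: b%:P]mul_polyC -polyCM -addrA -polyCD.
rewrite !horner_comp -g1 -h1 -g2 -h2; split=> //.
by rewrite -comp_polyA f1 comp_polyA f2 comp_polyA.
Qed.

Canonical affine_conj_equiv :=
  EquivRel affine_conj affine_conj_refl affine_conj_sym affine_conj_trans.

Definition P3crit := {eq_quot affine_conj_equiv}.

Definition mc_class (T : markedCubic) : P3crit := \pi_P3crit T.

Lemma mc_classE (T U : markedCubic) :
  mc_class T = mc_class U <->
  exists a b : C, a != 0 /\ conj_by a b T U.
Proof.
split=> [/eqmodP /asboolP //|h]; exact/eqmodP/asboolP.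
Qed.

Definition preperiodic (f : {poly C}) (c : C) (n l : nat) : Prop :=
  let fk k := iter k (horner f) c in
  match l with
  | 0 => fk n = c
  | l'.+1 => fk (l + n)%N = fk l /\ fk (l' + n)%N <> fk l'
  end.

Definition C1 (n l : nat) : set P3crit :=
  [set mc_class T | T in
    [set T : markedCubic | preperiodic (mc_map T) (mc_crit1 T) n l]].

Definition C2 (m l : nat) : set P3crit :=
  [set mc_class T | T in
    [set T : markedCubic | preperiodic (mc_map T) (mc_crit2 T) m l]].

End CubicModuli.

(* f_{x,y}(z), over an arbitrary ring so that the same formula gives the
   polynomial in z and, for indeterminate x and y, the curve equations. *)
Definition fxy (A : nzRingType) (x y z : A) : A := z ^+ 3 - 3%:R * x ^+ 2 * z + y.

Section Coordinates.
Variable R : realType.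
Local Notation C := R[i].

Definition fxy_poly (x y : C) : {poly C} := fxy x%:P y%:P 'X.

Lemma fxy_poly_deriv (x y : C) :
  (fxy_poly x y)^`() = 3%:R *: (('X - x%:P) * ('X - (- x)%:P)).
Proof.
rewrite /fxy_poly /fxy -polyC_natr -polyC_exp -polyCM mul_polyC.
rewrite derivD derivB derivC addr0 derivXn derivZ derivX -!mul_polyC.
rewrite -mulr_natl /=; ring.
Qed.

Lemma fxy_poly_marked (x y : C) : is_marked_cubic (fxy_poly x y, x, - x).
Proof.
have hs : size (fxy_poly x y) = 4.
  rewrite /fxy_poly /fxy -addrA size_polyDl size_polyXn //.
  rewrite -polyC_natr -polyC_exp -polyCM -mulNr -polyCN.
  by rewrite size_MXaddC; case: ifP=> // _; rewrite ltnS (leq_ltn_trans (size_polyC_leq1 _)).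
rewrite /is_marked_cubic hs eqxx /= fxy_poly_deriv.
rewrite lead_coefZ lead_coef_Mmonic ?monicXsubC // lead_coefXsubC mulr1.
by rewrite eqxx.
Qed.

Definition mc_xy (x y : C) : markedCubic R := MarkedCubic (fxy_poly_marked x y).

(* Curve equations live in C[x, y], with x the variable of index 0 and y that of
   index 1. *)
Definition varx : {mpoly C[2]} := 'X_ord0.
Definition vary : {mpoly C[2]} := 'X_ord_max.
Definition xy (x y : C) : 'I_2 -> C := fun k => if k == ord0 then x else y.

Definition preper_eqn (c : {mpoly C[2]}) (n l : nat) : {mpoly C[2]} :=
  iter (l + n) (fxy varx vary) c - iter l (fxy varx vary) c.

Definition C1_eqn (n l : nat) := preper_eqn varx n l.
Definition C2_eqn (m l : nat) := preper_eqn (- varx) m l.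

Definition jacobian (P Q : {mpoly C[2]}) : {mpoly C[2]} :=
  P^`M(ord0) * Q^`M(ord_max) - P^`M(ord_max) * Q^`M(ord0).

(* C1_eqn n l and C2_eqn m k are the unfactored defining equations; the open
   conditions of the curves are part of C1 n l and C2 m k. *)
Definition intersect_transversally (n l m k : nat) : Prop :=
  forall p : P3crit R, (C1 n l `&` C2 m k) p ->
  forall x y : C, p = mc_class (mc_xy x y) ->
  (jacobian (C1_eqn n l) (C2_eqn m k)).@[xy x y] != 0.

Lemma hornerfxy (x y z : C) : (fxy_poly x y).[z] = fxy x y z.
Proof. by rewrite /fxy_poly /fxy -polyC_natr -polyC_exp !hornerE. Qed.

Lemma meval_preper_eqn (x y : C) (c : {mpoly C[2]}) (n l : nat) :
  (preper_eqn c n l).@[xy x y] =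
  iter (l + n) (horner (fxy_poly x y)) c.@[xy x y] -
  iter l (horner (fxy_poly x y)) c.@[xy x y].
Proof.
have H k : (iter k (fxy varx vary) c).@[xy x y] =
           iter k (horner (fxy_poly x y)) c.@[xy x y].
  elim: k => //= k <-; rewrite hornerfxy /fxy.
  by rewrite mevalD mevalB !mevalM mevalXU mevalXU ?rmorphXn ?rmorph_nat.
by rewrite /preper_eqn mevalB !H.
Qed.

Lemma preperiodic_conj (f g : {poly C}) (a b c : C) (n l : nat) :
  let phi := a *: 'X + b%:P in
  a != 0 -> phi \Po f = g \Po phi ->
  preperiodic f c n l <-> preperiodic g phi.[c] n l.
Proof.
move=> phi a0 h.
have phi_inj : injective (horner phi).
  by move=> u v; rewrite /phi !hornerE => /addIr /(mulfI a0).
have it k : iter k (horner g) phi.[c] = phi.[iter k (horner f) c].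
  by elim: k => //= k ->; rewrite -!horner_comp h.
case: l => [|l]; rewrite /preperiodic !it.
  by split=> [->//|/phi_inj].
split=> -[e ne]; split.
- by rewrite e.
- by move/phi_inj.
- exact: phi_inj.
- by move=> e'; apply: ne; rewrite e'.
Qed.

Lemma C1_classE (T : markedCubic R) (n l : nat) :
  C1 n l (mc_class T) <-> preperiodic (mc_map T) (mc_crit1 T) n l.
Proof.
split=> [[U hU /mc_classE[a [b [a0 [hf h1 _]]]]]|hT]; last by exists T.
by rewrite h1; apply/(preperiodic_conj _ _ _ a0 hf).
Qed.

Lemma C2_classE (T : markedCubic R) (n l : nat) :
  C2 n l (mc_class T) <-> preperiodic (mc_map T) (mc_crit2 T) n l.
Proof.
split=> [[U hU /mc_classE[a [b [a0 [hf _ h2]]]]]|hT]; last by exists T.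
by rewrite h2; apply/(preperiodic_conj _ _ _ a0 hf).
Qed.

Lemma deriv_horner_inj (p q : {poly C}) (c : C) :
  p^`() = q^`() -> p.[c] = q.[c] -> p = q.
Proof.
move=> hd hc; apply/eqP; rewrite -subr_eq0; apply/eqP; set r := p - q.
have r0 : r^`() = 0 by rewrite /r derivB hd subrr.
have rC : r = (r`_0)%:P.
  apply/polyP=> -[|k]; rewrite coefC //=.
  have /eqP := congr1 (fun s : {poly C} => s`_k) r0.
  by rewrite coef_deriv coef0 mulrn_eq0 /= => /eqP.
have : r.[c] = 0 by rewrite /r hornerD hornerN hc subrr.
by rewrite rC hornerC => ->.
Qed.

(* Every point of the moduli space has such coordinates, so
   [intersect_transversally] constrains every intersection point. *)
Lemma mc_xy_surj (p : P3crit R) : exists x y : C, p = mc_class (mc_xy x y).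
Proof.
have [T ->] : exists T, p = mc_class T by exists (repr p); rewrite /mc_class reprK.
case: T => [[[f c1 c2] hT]].
have /andP[/eqP hs /eqP hd] := hT.
set a := lead_coef f^`() in hd.
have f0 : f != 0 by rewrite -size_poly_eq0 hs.
have a0 : a != 0.
  rewrite /a lead_coef_eq0; apply/eqP => e.
  have : (f^`())`_2 = f`_3 *+ 3 by rewrite coef_deriv.
  have : lead_coef f != 0 by rewrite lead_coef_eq0.
  rewrite lead_coefE hs /= e coef0 => h /esym /eqP.
  by rewrite mulrn_eq0 (negPf h).
pose u : C := sqrtC (a / 3%:R).
have h2 : (2%:R : C) != 0 by rewrite pnatr_eq0.
have h3 : (3%:R : C) != 0 by rewrite pnatr_eq0.
have hu : u ^+ 2 * 3%:R = a by rewrite /u sqrtCK divfK.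
have u0 : u != 0.
  by apply: contra a0 => /eqP e; rewrite -hu e expr0n mul0r.
pose b : C := - u * (c1 + c2) / 2%:R.
pose x : C := u * (c1 - c2) / 2%:R.
pose phi : {poly C} := u *: 'X + b%:P.
have px1 : phi.[c1] = x by rewrite /phi !hornerE /b /x; field.
have px2 : phi.[c2] = - x by rewrite /phi !hornerE /b /x; field.
pose y : C := (phi \Po f).[c1] - fxy x 0 x.
exists x, y; apply/mc_classE; exists u, b; split=> //.
rewrite /conj_by -/phi /mc_crit1 /mc_crit2 /mc_map /= px1 px2; split=> //.
apply: (@deriv_horner_inj _ _ c1); last first.
  by rewrite [RHS]horner_comp px1 hornerfxy /y /fxy; ring.
have dphi : phi^`() = u%:P by rewrite /phi derivD derivZ derivX derivC addr0 alg_polyC.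
rewrite !deriv_comp dphi comp_polyC hd fxy_poly_deriv.
rewrite comp_polyZ comp_polyM !comp_polyB comp_polyX !comp_polyC.
have -> : phi - x%:P = u%:P * ('X - c1%:P).
  by rewrite -px1 /phi !hornerE -mul_polyC; ring.
have -> : phi - (- x)%:P = u%:P * ('X - c2%:P).
  by rewrite -px2 /phi !hornerE -mul_polyC; ring.
rewrite -!mul_polyC -hu; ring.
Qed.

End Coordinates.

(* Main.v *)
Require Import Defs.
From HB Require Import structures.
From mathcomp Require Import all_boot all_order all_algebra.
From mathcomp Require Import ring.
From mathcomp Require Import complex mpoly boolp classical_sets reals.

Set Implicit Arguments.
Unset Strict Implicit.
Unset Printing Implicit Defensive.

Import GRing.Theory Num.Theory.
Local Open Scope ring_scope.

(** The proof is 3-adic.  Put F_k = f^k(x) and G_k = f^k(-x), where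
    f = f_{x,y}.  Since f(z) = z^3 + y modulo 3, the partial derivatives of F_k
    and G_k with respect to (x, y) are (0, 1) modulo 3 as soon as k >= 1
    ([grad_orbit_mod3]).

    For a critical point c of f one has the factorization
      f(w) - f(c) = (w - c)^2 (w + 2c),
    so the equation of the curve C_{1,n,1} is (F_n - x)^2 (F_n + 2x), and the
    open condition says that the first factor does not vanish.  On the curve the
    second factor is therefore zero, and up to the nonzero scalar (F_n - x)^2 the
    gradient of the equation is that of F_n + 2x = (F_n - x) + 3x, which is
    (-1, 1) modulo 3.  Likewise the gradient of the equation of C_{2,m,1} is, up
    to a nonzero scalar, that of (G_m + x) - 3x, which is (1, 1) modulo 3; and
    G_m + x is the equation of C_{2,m,0}.  Both parts of the theorem thus reduce
    to det ((-1, 1), (1, 1)) = -2 being 1 modulo 3 ([jacobian_neq0]).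

    For this to show that a complex number is nonzero, congruences modulo 3 must
    make sense at the intersection point: x and y have to lie in a subring of the
    complex numbers in which 3 is not invertible.  Such a subring is provided by
    a valuation ring V with 3 in its maximal ideal, which exists by Chevalley's
    theorem ([exists_valuation_ring], [exists_3adic_ring]).  The point lies in V
    ([critical_orbits_integral]): if x or y were not in V, then the larger of the
    critical values f(x) = y - 2x^3 and f(-x) = y + 2x^3 would dominate 1, x^3 and
    y, because 2 and 4 are units of V; its orbit would then grow at each step,
    whereas the equations force each critical orbit to come back to a small
    integer multiple of x. *)

(** * Existence of valuation rings *)

Section Adjoin.
Variables (K : fieldType) (A : subringClosed K) (z : K).

Definition adjoin : {pred K} :=
  fun u => `[< exists2 p : {poly K}, p \is a polyOver A & u = p.[z] >].

Lemma adjoin_subring : GRing.subring_closed adjoin.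
Proof.
split=> [|u v /asboolP[p Ap ->] /asboolP[q Aq ->]|u v /asboolP[p Ap ->] /asboolP[q Aq ->]].
- by apply/asboolP; exists 1; rewrite ?rpred1 ?hornerE.
- by apply/asboolP; exists (p - q); rewrite ?rpredB ?hornerE.
- by apply/asboolP; exists (p * q); rewrite ?rpredM ?hornerE.
Qed.

HB.instance Definition _ :=
  GRing.isSubringClosed.Build K adjoin adjoin_subring.

Lemma sub_adjoin : {subset A <= adjoin}.
Proof. by move=> u Au; apply/asboolP; exists u%:P; rewrite ?polyOverC ?hornerC. Qed.

Lemma mem_adjoin : z \in adjoin.
Proof. by apply/asboolP; exists 'X; rewrite ?polyOverX ?hornerX. Qed.

End Adjoin.

(** Clearing denominators in an element of A[1/w]. *)
Lemma polyOver_horner_inv (K : fieldType) (A : subringClosed K) (w : K)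
    (p : {poly K}) :
  w \in A -> w != 0 -> p \is a polyOver A -> p.[w^-1] * w ^+ size p \in A.
Proof.
move=> Aw w0 Ap; rewrite horner_coef mulr_suml rpred_sum // => i _.
have -> : w ^+ size p = w ^+ i * w ^+ (size p - i) by rewrite -exprD subnKC // ltnW.
rewrite mulrA exprVn mulfVK ?expf_neq0 //.
by rewrite rpredM ?rpredX //; apply: (polyOverP Ap).
Qed.

(** A subring A that is maximal among those that do not contain the inverse of
    some a in A is a valuation ring. *)
Section Maximal.
Variables (K : fieldType) (A : subringClosed K) (a : K).
Hypotheses (Aa : a \in A) (a0 : a != 0) (NAa : a^-1 \notin A).
Hypothesis maxA : forall B : subringClosed K,
  {subset A <= B} -> a^-1 \notin B -> {subset B <= A}.

Lemma maximal_adjoin (z : K) : z \notin A ->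
  exists2 p : {poly K}, p \is a polyOver A & a * p.[z] = 1.
Proof.
move=> NAz; have : a^-1 \in adjoin A z.
  apply: contraNT NAz => h.
  exact: (maxA (B := adjoin A z) (@sub_adjoin _ A z) h (mem_adjoin A z)).
by case/asboolP=> p Ap e; exists p; rewrite // -e mulfV.
Qed.

(** Multiples of [a] lie in the Jacobson radical of [A]: were 1/(1 - ab) missing
    from [A], adjoining it would yield 1/a, and clearing denominators would give
    an identity (1 - ab)^k = a d with d in [A]; but (1 - ab)^k is also 1 modulo a,
    so that a would be a unit. *)
Lemma maximal_unit (b : K) : b \in A -> (1 - a * b)^-1 \in A.
Proof.
move=> Ab; set w := 1 - a * b.
have Aw : w \in A by rewrite rpredB ?rpred1 ?rpredM.
apply: contraT => /maximal_adjoin[p Ap e].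
have w0 : w != 0.
  apply: contra NAa; rewrite subr_eq0 => /eqP e1.
  suff -> : a^-1 = b by [].
  by apply: (mulfI a0); rewrite mulfV.
have h := polyOver_horner_inv Aw w0 Ap.
(* A power of 1 - ab is 1 modulo a. *)
have [c Ac hc] : exists2 c, c \in A & w ^+ size p = 1 - a * c.
  elim: (size p) => [|k [c Ac IH]]; first by exists 0; rewrite ?rpred0 // mulr0 subr0.
  exists (c + b * w ^+ k); first by rewrite rpredD ?rpredM ?rpredX.
  by rewrite exprS {1}/w IH; ring.
move: NAa; suff -> : a^-1 = p.[w^-1] * w ^+ size p + c by rewrite rpredD.
apply: (mulfI a0); rewrite mulrDr mulrA e mul1r hc mulfV //; ring.
Qed.

(** Multiplying 1 = a q(1/z) by a power of [z] and dividing by the unit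
    1 - a q(0) turns the relation into one that lowers powers of [z]. *)
Lemma maximal_monic_relation (z : K) (q : {poly K}) :
  z != 0 -> q \is a polyOver A -> a * q.[z^-1] = 1 ->
  exists2 s : {poly K}, s \is a polyOver A &
    (size s < size q)%N /\ z ^+ (size q).-1 = a * s.[z].
Proof.
move=> z0 Aq e.
have Aq_ i : q`_i \in A := polyOverP Aq i.
set k := (size q).-1.
have sq : size q = k.+1.
  rewrite prednK // size_poly_gt0; apply: contra_eqN e => /eqP ->.
  by rewrite horner0 mulr0 eq_sym oner_eq0.
have Ae := maximal_unit (Aq_ 0).
set w := 1 - _ in Ae.
have w0 : w != 0.
  apply: contraNneq NAa => e1; suff -> : a^-1 = q`_0 by [].
  by apply: (mulfI a0); rewrite mulfV //; apply: subr0_eq.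
exists (\poly_(i < k) (w^-1 * q`_(k - i))).
  by apply/polyOverP => i; rewrite coef_poly; case: ifP => _; rewrite ?rpred0 ?rpredM.
rewrite sq ltnS size_poly; split=> //.
rewrite horner_poly.
apply: (mulfI w0); rewrite mulrCA mulr_sumr.
under eq_bigr => i _ do rewrite !mulrA mulfV // mul1r.
have -> : \sum_(i < k) q`_(k - i) * z ^+ i = \sum_(i < k) q`_i.+1 * z ^+ (k - i.+1).
  rewrite (reindex_inj rev_ord_inj) /=; apply: eq_bigr => i _.
  by rewrite subKn.
have: a * q.[z^-1] * z ^+ k = z ^+ k by rewrite e mul1r.
rewrite horner_coef sq big_ord_recl expr0 mulr1 mulrDr mulrDl.
rewrite -[_ * _ * z ^+ k]mulrA -/w mulr_sumr mulr_suml => h.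
rewrite {1}/w mulrBl mul1r -{1}h -mulrA addrC addKr mulr_sumr.
apply: eq_bigr => i _.
have -> : z ^+ k = z ^+ i.+1 * z ^+ (k - i.+1) by rewrite -exprD subnKC.
by rewrite /= exprVn; field; rewrite ?expf_neq0.
Qed.

(** Otherwise 1 = a p(z) and 1 = a q(1/z) for some polynomials p and q over [A].
    If deg q <= deg p, the monic relation for z obtained from q removes the
    leading term of p; if deg p < deg q, exchange the roles of z and 1/z.  This
    descent cannot go on forever. *)
Lemma maximal_valuation (z : K) : z \notin A -> z^-1 \in A.
Proof.
suff H N : forall (t : K) (p q : {poly K}), (size p + size q <= N)%N ->
    p \is a polyOver A -> q \is a polyOver A -> a * p.[t] = 1 ->
    a * q.[t^-1] = 1 -> t != 0 -> False.
  move=> Az; apply: contraT => Azi.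
  have [p Ap ep] := maximal_adjoin Az; have [q Aq eq] := maximal_adjoin Azi.
  case: (H _ z p q (leqnn _) Ap Aq ep eq).
  by apply: contraNneq Az => ->; rewrite rpred0.
elim: N => [|N IH] t p q; last first.
  wlog le_qp : t p q / (size q <= size p)%N.
    move=> W hN Ap Aq ep eq t0; case: (leqP (size q) (size p)) => h; first exact: W h hN Ap Aq ep eq t0.
    by apply: (W t^-1 q p) (ltnW h) _ Aq Ap eq _ _; rewrite 1?addnC ?invrK ?invr_eq0.
  move=> hN Ap Aq ep eq t0.
  have [s As [szs es]] := maximal_monic_relation t0 Aq eq.
  set n := (size p).-1; set k := (size q).-1 in es.
  have hp : size p = n.+1.
    rewrite prednK // size_poly_gt0; apply: contra_eqN ep => /eqP ->.
    by rewrite horner0 mulr0 eq_sym oner_eq0.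
  have hq : size q = k.+1 by rewrite prednK // (leq_ltn_trans _ szs).
  have le_kn : (k <= n)%N by rewrite -ltnS -hq -hp.
  rewrite hq ltnS in szs.
  (* g is monic of degree k and vanishes at t. *)
  pose g := 'X^k - a *: s : {poly K}.
  pose r := p - p`_n *: (g * 'X^(n - k)).
  have g0 : g.[t] = 0 by rewrite !hornerE es subrr.
  have Ag : g \is a polyOver A by rewrite rpredB ?polyOverXn // polyOverZ.
  apply: (IH t r q) => //.
  - apply: leq_trans (_ : n + size q <= N)%N; last by rewrite hp in hN.
    rewrite leq_add2r; apply/leq_sizeP => j hj.
    rewrite coefB coefZ coefMXn.
    have -> : (j < n - k)%N = false by apply/negbTE; rewrite -leqNgt (leq_trans (leq_subr _ _)).
    rewrite coefB coefXn coefZ [s`__]nth_default ?mulr0 ?subr0; last first.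
      by rewrite (leq_trans szs) // leq_subRL ?subnK // (leq_trans (leq_subr _ _)).
    move: hj; rewrite leq_eqVlt => /orP[/eqP <-|hj].
      by rewrite subKn // eqxx mulr1 subrr.
    rewrite nth_default ?hp //.
    have -> : (j - (n - k) == k)%N = false.
      by apply/negbTE; rewrite -(eqn_add2r (n - k)) subnK ?subnKC // ?(gtn_eqF hj) // (leq_trans (leq_subr _ _)) // ltnW.
    by rewrite mulr0 subr0.
  - by rewrite rpredB // polyOverZ ?rpredM ?polyOverXn //; apply: (polyOverP Ap).
  - by rewrite /r hornerD hornerN hornerZ hornerM g0 mul0r mulr0 subr0.
rewrite leqn0 addn_eq0 size_poly_eq0 => /andP[/eqP -> _] _ _.
by rewrite horner0 mulr0 => /esym/eqP; rewrite oner_eq0.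
Qed.

End Maximal.

(** Chevalley's theorem for a principal ideal.  Zorn's lemma is applied to the
    sets B whose union with [A] is a subring without 1/a, rather than to the
    subrings themselves, so that the empty chain needs no special care. *)
Theorem exists_valuation_ring (K : fieldType) (A : subringClosed K) (a : K) :
  a \in A -> a^-1 \notin A ->
  exists2 V : subringClosed K, {subset A <= V} /\ a^-1 \notin V &
    forall z, z \notin V -> z^-1 \in V.
Proof.
move=> Aa NAa.
pose U (B : set K) : {pred K} := fun u => (u \in A) || `[< B u >].
have inU B u : (u \in U B) = (u \in A) || `[< B u >] by [].
have sAU B : {subset A <= U B} by move=> u Au; rewrite inU Au.
have sBU (B : set K) u : B u -> u \in U B.
  by move=> Bu; rewrite inU; apply/orP; right; apply/asboolP.
pose P (B : set K) := GRing.subring_closed (U B) /\ a^-1 \notin U B.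
have [F FP Ftot|B [[PB NB] Bmax]] := @Zorn_bigcup K P.
  have key u v : u \in U (\bigcup_(X in F) X)%classic ->
      v \in U (\bigcup_(X in F) X)%classic -> exists W : {pred K},
      [/\ GRing.subring_closed W, {subset W <= U (\bigcup_(X in F) X)%classic},
          u \in W & v \in W].
    have sub X : F X -> {subset U X <= U (\bigcup_(X in F) X)%classic}.
      move=> FX w; rewrite inU => /orP[/sAU//|/asboolP Xw].
      by apply: sBU; exists X.
    have inA : GRing.subring_closed (fun w => w \in A).
      by split=> [|? ? ? ?|? ? ? ?]; rewrite ?rpred1 ?rpredB ?rpredM.
    rewrite !inU => /orP[Au|/asboolP[X FX Xu]] /orP[Av|/asboolP[Y FY Yv]].
    - by exists (fun w => w \in A); split=> //; apply: sAU.
    - exists (U Y); split; [exact: (FP _ FY).1|exact: sub|exact: sAU|exact: sBU].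
    - exists (U X); split; [exact: (FP _ FX).1|exact: sub|exact: sBU|exact: sAU].
    - have [XY|YX] := Ftot _ _ FX FY.
        exists (U Y); split; [exact: (FP _ FY).1|exact: sub| |exact: sBU].
        exact/sBU/XY.
      exists (U X); split; [exact: (FP _ FX).1|exact: sub|exact: sBU|].
      exact/sBU/YX.
  split; last first.
    rewrite inU (negPf NAa) /=; apply/asboolPn => -[X FX Xa].
    by case: (FP _ FX) => _ /negP; apply; apply: sBU.
  split=> [|u v Uu Uv|u v Uu Uv]; first by rewrite sAU ?rpred1.
    by have [W [[_ WB _] sW Wu Wv]] := key u v Uu Uv; apply/sW/WB.
  by have [W [[_ _ WM] sW Wu Wv]] := key u v Uu Uv; apply/sW/WM.
pose V : subringClosed K := HB.pack (U B) (GRing.isSubringClosed.Build K (U B) PB).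
have sAV : {subset A <= V} := sAU B.
exists V => // z; apply: (maximal_valuation (a := a)) => //.
- exact: sAV.
- by apply: contraNneq NAa => ->; rewrite invr0 rpred0.
move=> C sVC NC u Cu; apply: contraT => NVu.
have [] := Bmax [set w | w \in C]%classic.
  split=> [w Bw|h].
    by apply: sVC; apply: sBU.
  by case/negP: NVu; apply/sBU/h.
have UC : U [set w | w \in C]%classic = C :> {pred K}.
  apply/funext => w; apply/idP/idP => [/orP[Aw|/asboolP //]|Cw].
    exact/sVC/sAV.
  by apply/orP; right; apply/asboolP.
rewrite /P UC; split=> //.
by split=> [|? ? ? ?|? ? ? ?]; rewrite ?rpred1 ?rpredB ?rpredM.
Qed.

(** * Integrality of the critical orbits *)

Section ThreeAdicBounds.
Variables (K : fieldType) (V : subringClosed K).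
Hypothesis valV : forall z, z \notin V -> z^-1 \in V.

(** The noninvertible elements of [V]; when [V] is a valuation ring, elements
    outside [V] have their inverse in [V], hence do not qualify. *)
Definition in_maxideal (z : K) : Prop := forall w, w \in V -> w * z != 1.

Lemma maxidealM u z : u \in V -> in_maxideal z -> in_maxideal (u * z).
Proof. by move=> Vu mz w Vw; rewrite mulrA mz ?rpredM. Qed.

Lemma maxidealD u v : in_maxideal u -> in_maxideal v -> in_maxideal (u + v).
Proof.
have W u' v' : in_maxideal u' -> u' != 0 -> v' / u' \in V -> in_maxideal (u' + v').
  move=> mu u0 Vq w Vw; have -> : w * (u' + v') = (w * (1 + v' / u')) * u' by field.
  by rewrite mu ?rpredM ?rpredD ?rpred1.
move=> mu mv; have [->|u0] := eqVneq u 0; first by rewrite add0r.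
have [->|v0] := eqVneq v 0; first by rewrite addr0.
have [/W h|/valV] := boolP (v / u \in V); first exact: h.
by rewrite invf_div addrC => /W; apply.
Qed.

Lemma maxideal_inv z : z \notin V -> in_maxideal z^-1.
Proof.
move=> NVz w Vw; have z0 : z != 0 by apply: contraNneq NVz => ->; rewrite rpred0.
by apply: contraNneq NVz => e; rewrite -[z]mul1r -e mulfVK.
Qed.

Lemma maxideal_1D_neq0 z : in_maxideal z -> 1 + z != 0.
Proof.
move=> mz; apply/eqP => e; have /eqP[] := mz (- 1) (rpredN1 V).
by rewrite mulN1r; apply/eqP; rewrite -subr_eq0 -opprD addrC e oppr0.
Qed.

Lemma maxideal_1D_unit z : in_maxideal z -> (1 + z)^-1 \in V.
Proof.
move=> mz; apply: contraT => /maxideal_inv; rewrite invrK => m1.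
have VN1 : - 1 \in V by rewrite rpredN1.
have /(_ 1 (rpred1 V)) := maxidealD m1 (maxidealM VN1 mz).
by rewrite mulN1r addrK mul1r eqxx.
Qed.

Lemma valuation_root z k : z ^+ k.+1 \in V -> z \in V.
Proof.
move=> Vz; apply: contraT => NVz; have := valV NVz; have z0 : z != 0.
  by apply: contraNneq NVz => ->; rewrite rpred0.
move=> Vzi; case/negP: NVz.
have -> : z = z ^+ k.+1 * z^-1 ^+ k by rewrite exprS -mulrA -exprMn mulfV ?expr1n ?mulr1.
by rewrite rpredM // rpredX.
Qed.

Hypothesis V3 : in_maxideal 3%:R.

Variables x y : K.

(** In valuation terms: |z| > 1, |x|^3 <= |z| and |y| <= |z|. *)
Definition escaping (z : K) :=
  [/\ z \notin V, x ^+ 3 / z \in V & y / z \in V].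

(** Under these inequalities |x| < |z|, so that z^3 is the dominant term of
    f(z) = z^3 - 3 x^2 z + y, and |f(z)| = |z|^3 > |z|. *)
Lemma escaping_fxy z : escaping z -> escaping (fxy x y z).
Proof.
move=> [NVz Vx Vy]; have z0 : z != 0 by apply: contraNneq NVz => ->; rewrite rpred0.
have Vz := valV NVz; have mz := maxideal_inv NVz.
have Vxz : x / z \in V.
  apply: (@valuation_root _ 2).
  have -> : (x / z) ^+ 3 = x ^+ 3 / z * z^-1 ^+ 2 by field.
  by rewrite rpredM ?rpredX.
(* f(z) / z^3 = 1 + e with e in the maximal ideal. *)
pose e := - (x / z) ^+ 2 * 3%:R + (y / z * z^-1) * z^-1.
have me : in_maxideal e by apply: maxidealD; apply: maxidealM; rewrite ?rpredN ?rpredX // rpredM.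
have fE : fxy x y z = z ^+ 3 * (1 + e) by rewrite /fxy /e; field.
have e0 := maxideal_1D_neq0 me; have Ve := maxideal_1D_unit me.
have Vr u : u / z \in V -> u / fxy x y z \in V.
  move=> Vu; have -> : u / fxy x y z = u / z * z^-1 ^+ 2 * (1 + e)^-1 by rewrite fE; field; rewrite e0 z0.
  by rewrite rpredM // rpredM // rpredX.
split; [|exact: Vr|exact: Vr].
have mf : in_maxideal (fxy x y z)^-1.
  have -> : (fxy x y z)^-1 = (z^-1 ^+ 2 * (1 + e)^-1) * z^-1 by rewrite fE; field; rewrite e0 z0.
  by apply: maxidealM => //; rewrite rpredM ?rpredX.
apply/negP => /mf; rewrite mulfV ?eqxx // fE mulf_neq0 ?expf_neq0 //.
Qed.

(** |x|^3 <= |z| and |z| > 1 give |x| < |z|. *)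
Lemma escaping_not_multiple z t : escaping z -> t \in V -> z != t * x.
Proof.
move=> [NVz Vx Vy] Vt; apply/eqP => e.
have z0 : z != 0 by apply: contraNneq NVz => ->; rewrite rpred0.
have mz := maxideal_inv NVz.
have Vw : t ^+ 3 * (x ^+ 3 / z) * z^-1 \in V by rewrite rpredM ?valV // rpredM // rpredX.
by have /eqP[] := mz _ Vw; rewrite [t ^+ 3 * _]mulrA -exprMn -e; field.
Qed.

Lemma escaping_orbit z t k : t \in V -> iter k (fxy x y) z = t * x -> ~ escaping z.
Proof.
move=> Vt e Ez; have : escaping (iter k (fxy x y) z).
  by elim: {e}k => //= k; apply: escaping_fxy.
by move/escaping_not_multiple => /(_ t Vt); rewrite e eqxx.
Qed.

(** The critical values u = y - 2x^3 and v = y + 2x^3 determine x^3 = (v - u)/4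
    and y = (u + v)/2 over [V], since 2 and 4 are units of [V].  So if u or v is
    outside [V], the larger of the two escapes. *)
Lemma critical_orbits_integral t1 t2 k1 k2 : t1 \in V -> t2 \in V ->
  iter k1.+1 (fxy x y) x = t1 * x -> iter k2.+1 (fxy x y) (- x) = t2 * x ->
  x \in V /\ y \in V.
Proof.
move=> Vt1 Vt2; rewrite !iterSr => /escaping_orbit-/(_ Vt1) NE1.
move=> /escaping_orbit-/(_ Vt2) NE2.
set u := fxy x y x in NE1; set v := fxy x y (- x) in NE2.
(* The units 4 and 2 are written 1 + 3 and, up to sign, 1 - 3. *)
have V1 : 1 \in V by rewrite rpred1.
have m3 : in_maxideal (1 * 3%:R) := maxidealM V1 V3.
have mN3 : in_maxideal (-1 * 3%:R) := maxidealM (rpredN1 V) V3.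
have n4 := maxideal_1D_neq0 m3; have V4 := maxideal_1D_unit m3.
have n2 := maxideal_1D_neq0 mN3; have V2 := maxideal_1D_unit mN3.
set c4 := 1 + _ in n4 V4; set c2 := 1 + _ in n2 V2.
have xE : x ^+ 3 = c4^-1 * (v - u).
  by rewrite /u /v /fxy; apply: (mulfI n4); rewrite mulVKf // /c4; ring.
have yE : y = - c2^-1 * (u + v).
  by apply: (mulfI n2); rewrite mulNr mulrN mulVKf // /u /v /fxy /c2; ring.
have D w w' : w \notin V -> w' / w \in V ->
    x ^+ 3 = c4^-1 * (w' - w) \/ x ^+ 3 = - (c4^-1 * (w' - w)) ->
    y = - c2^-1 * (w + w') -> escaping w.
  move=> NVw Vq hx hy; have w0 : w != 0 by apply: contraNneq NVw => ->; rewrite rpred0.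
  have Vxw : c4^-1 * (w' / w - 1) \in V by rewrite rpredM ?rpredB.
  split=> //.
    by case: hx => ->; rewrite ?mulNr ?rpredN -mulrA mulrBl mulfV.
  by rewrite hy -mulrA mulrDl mulfV // rpredM ?rpredN ?rpredD.
have D1 : u \notin V -> v / u \in V -> False.
  by move=> NVu Vq; apply: NE1; apply: (D u v) => //; left.
have D2 : v \notin V -> u / v \in V -> False.
  move=> NVv Vq; apply: NE2; apply: (D v u) => //; last by rewrite [v + u]addrC.
  by right; rewrite xE; ring.
have half w w' : w \notin V -> w' / w \in V \/ w' \notin V /\ w / w' \in V.
  move=> NVw; have w0 : w != 0 by apply: contraNneq NVw => ->; rewrite rpred0.
  have [|NVq] := boolP (w' / w \in V); first by left.
  right; have := valV NVq; rewrite invf_div; split=> //.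
  by apply: contraNN NVq => Vw'; rewrite rpredM ?valV.
have Vu : u \in V.
  by apply: contraT => NVu; case: (half u v NVu) => [/(D1 NVu)|[/D2]].
have Vv : v \in V.
  by apply: contraT => NVv; case: (half v u NVv) => [/(D2 NVv)|[/D1]].
split; last first.
  rewrite yE rpredM //; last by rewrite rpredD.
  by rewrite rpredN.
by apply: (@valuation_root _ 2); rewrite xE rpredM ?rpredB.
Qed.

End ThreeAdicBounds.

(** The integers in [K] form a ring without 1/3, from which Chevalley's theorem
    can start. *)
Lemma exists_3adic_ring (K : numFieldType) :
  exists2 V : subringClosed K, in_maxideal V 3%:R & forall z, z \notin V -> z^-1 \in V.
Proof.
pose Z : {pred K} := fun u => `[< exists m : int, u = m%:~R >].
have ZP : GRing.subring_closed Z.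
  split=> [|u w /asboolP[m ->] /asboolP[k ->]|u w /asboolP[m ->] /asboolP[k ->]].
  - by apply/asboolP; exists 1.
  - by apply/asboolP; exists (m - k); rewrite intrB.
  - by apply/asboolP; exists (m * k); rewrite intrM.
pose A : subringClosed K := HB.pack Z (GRing.isSubringClosed.Build K Z ZP).
have n3 : 3%:R != 0 :> K by rewrite pnatr_eq0.
have A3 : 3%:R \in A by rewrite rpred_nat.
have NA3 : 3%:R^-1 \notin A.
  apply/negP => /asboolP[m /(congr1 (fun t => 3%:R * t))].
  rewrite mulfV // -[3%:R]/(3%:Z%:~R) -intrM => /esym/eqP.
  rewrite -[1]/(1%:~R) eqr_int => /eqP e.
  have : (3 %| 1)%Z by apply/dvdzP; exists m; rewrite mulrC.
  by [].
have [V [_ NV3] valV] := exists_valuation_ring A3 NA3.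
exists V => // w Vw; apply: contraNneq NV3 => e.
have -> : 3%:R^-1 = w by apply: (mulIf n3); rewrite e mulVf.
exact: Vw.
Qed.

(** * Gradients modulo 3 *)

(** The left-hand side is the partial derivative of w^3 - 3 x^2 w + y as the
    Leibniz rule delivers it. *)
Lemma fxy_partialE (A : comNzRingType) (x w w' x' y' : A) :
  w' * (w * w) + w * (w' * w + w * w')
  - ((x' * x + x * x') * w + x * x * w'
     + ((x' * x + x * x') * w + x * x * w'
        + ((x' * x + x * x') * w + x * x * w'))) + y'
  = 3%:R * ((w ^+ 2 - x ^+ 2) * w' - 2%:R * x * w * x') + y'.
Proof. ring. Qed.

Lemma fxy_partial_coef_mem (A : comNzRingType) (V : subringClosed A) (x w w' x' : A) :
  x \in V -> x' \in V -> w \in V -> w' \in V ->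
  (w ^+ 2 - x ^+ 2) * w' - 2%:R * x * w * x' \in V.
Proof.
move=> Vx Vx' Vw Vw'; apply: rpredB.
  by apply: rpredM => //; apply: rpredB; apply: rpredX.
by do 3! [apply: rpredM => //]; apply: rpred_nat.
Qed.

Lemma fxy_mem (A : comNzRingType) (V : subringClosed A) (x y z : A) :
  x \in V -> y \in V -> z \in V -> fxy x y z \in V.
Proof.
move=> Vx Vy Vz; apply: rpredD => //; apply: rpredB; first exact: rpredX.
by do 2! [apply: rpredM => //]; [apply: rpred_nat | apply: rpredX].
Qed.

(** The determinant of rows congruent to (-1, 1) and (1, 1) is -2, which is 1
    modulo 3; the rows are also scaled by s and t. *)
Lemma unimodular_mod3 (A : comNzRingType) (V : subringClosed A) (s t g h g' h' : A) :
  g \in V -> h \in V -> g' \in V -> h' \in V ->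
  exists2 e, e \in V &
  s * (- 1 + 3%:R * g) * (t * (1 + 3%:R * h')) -
  s * (1 + 3%:R * h) * (t * (1 + 3%:R * g')) = s * t * (1 + 3%:R * e).
Proof.
move=> Vg Vh Vg' Vh'; exists (g - h' - h - g' + 3%:R * (g * h' - h * g') - 1); last by ring.
have V3 : 3%:R \in V by apply: rpred_nat.
by rewrite !(rpredB, rpredD, rpredM, rpred1).
Qed.

Section Gradients.
Variables (R : realType) (V : subringClosed R[i]) (x y : R[i]).
Hypotheses (Vx : x \in V) (Vy : y \in V).
Local Notation C := R[i].
Local Notation v := (xy x y).
Local Notation X := (varx R).
Local Notation Y := (vary R).

Lemma meval_varx : X.@[v] = x. Proof. by rewrite /varx mevalXU. Qed.

Lemma meval_vary : Y.@[v] = y. Proof. by rewrite /vary mevalXU. Qed.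

Lemma meval_fxy (p : {mpoly C[2]}) : (fxy X Y p).@[v] = fxy x y p.@[v].
Proof.
by rewrite /fxy mevalD mevalB !exprS expr0 !mulr1 !mevalM rmorph_nat /= meval_varx meval_vary.
Qed.

Lemma meval_mderiv_fxy i (p : {mpoly C[2]}) :
  (fxy X Y p)^`M(i).@[v] =
  3%:R * ((p.@[v] ^+ 2 - x ^+ 2) * p^`M(i).@[v] - 2%:R * x * p.@[v] * X^`M(i).@[v])
  + Y^`M(i).@[v].
Proof.
rewrite -fxy_partialE /fxy -mulrA mulr_natl mderivD mderivB mderivMn.
rewrite !exprS expr0 !mulr1 !mderivM.
rewrite !mevalD mevalN !mevalM !mevalD !mevalM !mevalD !mevalM meval_varx.
by [].
Qed.

Lemma mderiv_varx : X^`M(ord0) = 1 /\ X^`M(ord_max) = 0.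
Proof.
split; rewrite mderivX mnm1E /= ?scale0r // scale1r.
by rewrite -mpolyX0; congr 'X_[_]; apply/mnmP => j; rewrite mnmBE subnn mnm0E.
Qed.

Lemma mderiv_vary : Y^`M(ord0) = 0 /\ Y^`M(ord_max) = 1.
Proof.
split; rewrite mderivX mnm1E /= ?scale0r // scale1r.
by rewrite -mpolyX0; congr 'X_[_]; apply/mnmP => j; rewrite mnmBE subnn mnm0E.
Qed.

Definition grad_mod3 (P : {mpoly C[2]}) (a b : C) : Prop :=
  exists g h, [/\ g \in V, h \in V, P^`M(ord0).@[v] = a + 3%:R * g &
                  P^`M(ord_max).@[v] = b + 3%:R * h].

(** The partial derivatives are values at (x, y) of polynomials with integer
    coefficients in x, y and the data of [c]. *)
Lemma orbit_integral (c : {mpoly C[2]}) k :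
  c.@[v] \in V -> c^`M(ord0).@[v] \in V -> c^`M(ord_max).@[v] \in V ->
  let p := iter k (fxy X Y) c in
  [/\ p.@[v] \in V, p^`M(ord0).@[v] \in V & p^`M(ord_max).@[v] \in V].
Proof.
have [X0 X1] := mderiv_varx; have [Y0 Y1] := mderiv_vary.
have V0 : 0 \in V by rewrite rpred0.
have V1 : 1 \in V by rewrite rpred1.
have V3 : 3%:R \in V by rewrite rpred_nat.
move=> Vc Vc0 Vc1; elim: k => [|k [Vp Vp0 Vp1]] p; first exact: And3 Vc Vc0 Vc1.
rewrite {}/p iterS !meval_mderiv_fxy meval_fxy X0 X1 Y0 Y1 meval0 meval1.
split; first exact: fxy_mem.
  exact: rpredD (rpredM V3 (fxy_partial_coef_mem Vx V1 Vp Vp0)) V0.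
exact: rpredD (rpredM V3 (fxy_partial_coef_mem Vx V0 Vp Vp1)) V1.
Qed.

(** In the derivative of f(p) = p^3 - 3 x^2 p + y only that of y survives
    modulo 3. *)
Lemma grad_orbit_mod3 (c : {mpoly C[2]}) k :
  c.@[v] \in V -> c^`M(ord0).@[v] \in V -> c^`M(ord_max).@[v] \in V ->
  grad_mod3 (iter k.+1 (fxy X Y) c) 0 1.
Proof.
move=> Vc Vc0 Vc1; have [Vp Vp0 Vp1] := orbit_integral k Vc Vc0 Vc1.
have [X0 X1] := mderiv_varx; have [Y0 Y1] := mderiv_vary.
have V0 : 0 \in V by rewrite rpred0.
have V1 : 1 \in V by rewrite rpred1.
rewrite /grad_mod3 iterS !meval_mderiv_fxy X0 X1 Y0 Y1 meval0 meval1.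
eexists; eexists; split; [exact: (fxy_partial_coef_mem Vx V1 Vp Vp0)
  |exact: (fxy_partial_coef_mem Vx V0 Vp Vp1)|exact: addrC|exact: addrC].
Qed.

(** The Jacobian is a nonzero multiple of a number congruent to 1 modulo 3, and
    such a number is not 0 because 3 is not invertible in [V]. *)
Lemma jacobian_neq0 (P Q P' Q' : {mpoly C[2]}) (s t : C) :
  in_maxideal V 3%:R -> s != 0 -> t != 0 ->
  (forall i, P^`M(i).@[v] = s * P'^`M(i).@[v]) ->
  (forall i, Q^`M(i).@[v] = t * Q'^`M(i).@[v]) ->
  grad_mod3 P' (-1) 1 -> grad_mod3 Q' 1 1 ->
  (jacobian P Q).@[v] != 0.
Proof.
move=> V3 s0 t0 hP hQ [g [h [Vg Vh Px Py]]] [g' [h' [Vg' Vh' Qx Qy]]].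
rewrite /jacobian mevalB 2!mevalM 2!hP 2!hQ Px Py Qx Qy.
have [e Ve ->] := unimodular_mod3 s t Vg Vh Vg' Vh'.
apply: mulf_neq0 (mulf_neq0 s0 t0) _; rewrite mulrC.
exact: maxideal_1D_neq0 (maxidealM Ve V3).
Qed.

Lemma grad_return_mod3 (c : {mpoly C[2]}) k s :
  c.@[v] \in V -> s \in V -> c^`M(ord0).@[v] = s -> c^`M(ord_max).@[v] = 0 ->
  grad_mod3 (preper_eqn c k.+1 0) (- s) 1.
Proof.
move=> Vc Vs c0 c1.
have Vc0 : c^`M(ord0).@[v] \in V by rewrite c0.
have Vc1 : c^`M(ord_max).@[v] \in V by rewrite c1 rpred0.
have [g [h [Vg Vh e0 e1]]] := grad_orbit_mod3 k Vc Vc0 Vc1.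
exists g, h; split; [exact: Vg|exact: Vh| |].
  by rewrite mderivB mevalB e0 c0 add0r addrC.
by rewrite mderivB mevalB e1 c1 subr0.
Qed.

Lemma grad_mod3_addM3 (P c : {mpoly C[2]}) a b :
  c^`M(ord0).@[v] \in V -> c^`M(ord_max).@[v] \in V ->
  grad_mod3 P a b -> grad_mod3 (P + c *+ 3) a b.
Proof.
move=> V0 V1 [g [h [Vg Vh e0 e1]]].
exists (g + c^`M(ord0).@[v]), (h + c^`M(ord_max).@[v]).
split; [exact: rpredD Vg V0|exact: rpredD Vh V1| |].
  by rewrite mderivD mderivMn mevalD mevalMn e0 mulrDr -addrA [_ * c^`M(_).@[v]]mulr_natl.
by rewrite mderivD mderivMn mevalD mevalMn e1 mulrDr -addrA [_ * c^`M(_).@[v]]mulr_natl.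
Qed.

End Gradients.

(** * The curve equations near an intersection point *)

(** The fiber of f over the critical value f(c) consists of c, with multiplicity
    two, and the cocritical point -2c; its equation w + 2c is written
    (w - c) + 3c because only w - c then matters modulo 3. *)
Lemma fxy_critical_fiber (A : comNzRingType) (x y c w : A) :
  c ^+ 2 = x ^+ 2 -> fxy x y w - fxy x y c = (w - c) ^+ 2 * (w - c + c *+ 3).
Proof. by move=> e; rewrite /fxy -e; ring. Qed.

Lemma preper_eqn1E (R : realType) (c : {mpoly R[i][2]}) n :
  c ^+ 2 = varx R ^+ 2 ->
  preper_eqn c n 1 = preper_eqn c n 0 ^+ 2 * (preper_eqn c n 0 + c *+ 3).
Proof. exact: fxy_critical_fiber. Qed.

Lemma preperiodic1_value (R : realType) (x y c : R[i]) n :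
  c ^+ 2 = x ^+ 2 -> preperiodic (fxy_poly x y) c n 1 ->
  iter n (horner (fxy_poly x y)) c - c != 0 /\
  iter n (horner (fxy_poly x y)) c - c + c *+ 3 = 0.
Proof.
move=> ec [e ne]; have d0 : iter n (horner (fxy_poly x y)) c - c != 0.
  by rewrite subr_eq0; apply/eqP.
split=> //; apply/eqP; move/eqP: e; rewrite /= !hornerfxy -subr_eq0.
by rewrite fxy_critical_fiber // mulf_eq0 expf_eq0 /= (negPf d0).
Qed.

(** On the curve the cocritical factor of the equation vanishes, so by the Leibniz
    rule only its own derivative contributes; the other factor becomes the nonzero
    scalar [s]. *)
Lemma mderiv_preper_eqn1 (R : realType) (c : {mpoly R[i][2]}) n (x y : R[i]) :
  c ^+ 2 = varx R ^+ 2 -> c.@[xy x y] ^+ 2 = x ^+ 2 ->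
  preperiodic (fxy_poly x y) c.@[xy x y] n 1 ->
  exists2 s, s != 0 & forall i, (preper_eqn c n 1)^`M(i).@[xy x y] =
    s * (preper_eqn c n 0 + c *+ 3)^`M(i).@[xy x y].
Proof.
move=> ec ecv /(preperiodic1_value ecv)[d0 b0].
have De := meval_preper_eqn x y c n 0.
have B0 : (preper_eqn c n 0 + c *+ 3).@[xy x y] = 0.
  by rewrite mevalD mevalMn De.
exists ((preper_eqn c n 0).@[xy x y] ^+ 2); first by rewrite De expf_neq0.
move=> i; rewrite (preper_eqn1E _ ec) expr2 mderivM mevalD 3!mevalM B0 mulr0 add0r.
by rewrite expr2.
Qed.

Section CriticalPoints.
Variables (R : realType) (V : subringClosed R[i]) (x y : R[i]).
Hypotheses (V3 : in_maxideal V 3%:R) (valV : forall z, z \notin V -> z^-1 \in V).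
Local Notation C := R[i].
Local Notation v := (xy x y).
Local Notation X := (varx R).

Lemma grad_return_crit2_mod3 m : x \in V -> y \in V ->
  grad_mod3 V x y (preper_eqn (- X) m.+1 0) 1 1.
Proof.
move=> Vx Vy; have [X0 X1] := mderiv_varx R.
have VN1 : -1 \in V by rewrite rpredN1.
have Vc : (- X).@[v] \in V by rewrite mevalN meval_varx rpredN.
rewrite -[1 in X in grad_mod3 _ _ _ _ X _]opprK.
apply: grad_return_mod3 => //.
  by rewrite mderivN X0 mevalN meval1.
by rewrite mderivN X1 oppr0 meval0.
Qed.

(** The common part of both cases: the second curve enters only through a return
    of the orbit of -x to a [V]-multiple of x, which gives integrality, and through
    a gradient proportional to one that is (1, 1) modulo 3. *)
Lemma transversal_to_C1 (Q Q' : {mpoly C[2]}) (t t2 : C) n m :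
  preperiodic (fxy_poly x y) x n.+1 1 ->
  iter m.+1 (horner (fxy_poly x y)) (- x) = t2 * x -> t2 \in V -> t != 0 ->
  (forall i, Q^`M(i).@[v] = t * Q'^`M(i).@[v]) ->
  (x \in V -> y \in V -> grad_mod3 V x y Q' 1 1) ->
  (jacobian (C1_eqn R n.+1 1) Q).@[v] != 0.
Proof.
move=> pre1 it2 Vt2 t0 hQ gQ.
have it z k : iter k (horner (fxy_poly x y)) z = iter k (fxy x y) z.
  by apply: eq_iter => w; rewrite hornerfxy.
have [_ b0] := preperiodic1_value (erefl _) pre1.
(* The orbit of x reaches the cocritical point -2x. *)
have it1 : iter n.+1 (fxy x y) x = - 2%:R * x.
  rewrite -it; set w := iter _ _ _ in b0 *; apply/eqP; rewrite -subr_eq0 -[X in _ == X]b0.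
  by apply/eqP; ring.
rewrite it in it2.
have VN2 : - 2%:R \in V by rewrite rpredN rpred_nat.
have [Vx Vy] := critical_orbits_integral valV V3 VN2 Vt2 it1 it2.
have Xv := meval_varx x y; have [X0 X1] := mderiv_varx R.
have pre1' : preperiodic (fxy_poly x y) X.@[v] n.+1 1 by rewrite Xv.
have [|s s0 hP] := mderiv_preper_eqn1 (erefl _) _ pre1'; first by rewrite Xv.
apply: (jacobian_neq0 V3 s0 t0 hP hQ) (gQ Vx Vy).
apply: grad_mod3_addM3; rewrite ?X0 ?X1 ?meval0 ?meval1 ?rpred0 ?rpred1 //.
by apply: grad_return_mod3; rewrite ?Xv ?X0 ?X1 ?meval0 ?meval1 ?rpred1.
Qed.

End CriticalPoints.

Theorem theorem13 (R : realType) (n m : nat) (hn : (0 < n)%N) (hm : (0 < m)%N) :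
  @intersect_transversally R n 1 m 0 /\ @intersect_transversally R n 1 m 1.
Proof.
have [V V3 valV] := exists_3adic_ring R[i].
case: n hn => // n _; case: m hm => // m _.
split=> p [C1p C2p] x y ep; rewrite {p}ep in C1p C2p;
    have pre1 : preperiodic (fxy_poly x y) x n.+1 1 by move/C1_classE: C1p.
  have pre2 : preperiodic (fxy_poly x y) (- x) m.+1 0 by move/C2_classE: C2p.
  apply: (transversal_to_C1 (m := m) (t := 1) (t2 := -1)
    (Q' := preper_eqn (- varx R) m.+1 0) V3 valV pre1).
  - by rewrite mulN1r.
  - by rewrite rpredN1.
  - exact: oner_neq0.
  - by move=> i; rewrite mul1r.
  - exact: grad_return_crit2_mod3.
have pre2 : preperiodic (fxy_poly x y) (- x) m.+1 1 by move/C2_classE: C2p.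
have [_ b0] := preperiodic1_value (sqrrN x) pre2.
have Xv : (- varx R).@[xy x y] = - x by rewrite mevalN meval_varx.
rewrite -Xv in pre2.
have [|t t0 hQ] := mderiv_preper_eqn1 (sqrrN _) _ pre2; first by rewrite Xv sqrrN.
(* The orbit of -x reaches the cocritical point 2x, whence t2 = 2. *)
apply: (transversal_to_C1 (m := m) (t2 := 2%:R) V3 valV pre1 _ _ t0 hQ).
- set w := iter _ _ _ in b0 *; apply/eqP; rewrite -subr_eq0 -[X in _ == X]b0.
  by apply/eqP; ring.
- by rewrite rpred_nat.
move=> Vx Vy; have [X0 X1] := mderiv_varx R.
apply: grad_mod3_addM3 (grad_return_crit2_mod3 m Vx Vy).
  by rewrite mderivN X0 mevalN meval1 rpredN1.
by rewrite mderivN X1 oppr0 meval0 rpred0.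
Qed.
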